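(* Let $M$ be a regular spacelike surface in $E_1^3$ with unit normal $N$, and let $\alpha: I\to M$ be a unit speed spacelike curve on $M$ with timelike principal normal and curvature $\kappa\neq 0$. Let $k_n,k_g,\tau_g$ be the normal curvature, geodesic curvature and geodesic torsion of $\alpha$. Then $\alpha$ is an isophote curve with a spacelike axis $d$, with $\theta$ the angle between $N$ and $d$, if and only if $$\tanh\theta=\omega(s)=\pm\left(\frac{k_n^2}{(k_n^2+\tau_g^2)^{3/2}}\left(\frac{\tau_g}{k_n}\right)'+\frac{k_g}{(k_n^2+\tau_g^2)^{1/2}}\right)(s)$$ is a constant function; that is, there is an isophote axis $d$ that is spacelike if and only if there is a constant $\theta$ such that, for one choice of the sign, $\omega(s)=\tanh\theta$ for all $s\in I$.
   Context: $E_1^3$ is $\mathbb{R}^3$ with the inner product $\langle x,y\rangle=-x_1y_1+x_2y_2+x_3y_3$. A vector $x$ is spacelike if $\langle x,x\rangle>0$ or $x=0$, timelike if $\langle x,x\rangle<0$. A surface is spacelike if its induced metric is positive definite; its unit normal $N$ is then timelike, $\langle N,N\rangle=-1$, and every regular curve on it is spacelike. The Lorentzian cross product is $x\times y=(x_2y_3-x_3y_2,\;x_1y_3-x_3y_1,\;x_2y_1-x_1y_2)$. For a unit speed curve $\alpha$ on the spacelike surface $M$, the Darboux frame is $\{T,\,B=N\times T,\,N\}$, where $T=\alpha'$ and $N$ is the unit normal of $M$ along $\alpha$; $\langle T,T\rangle=\langle B,B\rangle=1$, $\langle N,N\rangle=-1$. The functions $k_g,k_n,\tau_g$ are defined by $T'=k_gB+k_nN$,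 $B'=-k_gT+\tau_gN$, $N'=k_nT+\tau_gB$. The principal normal $n$ of $\alpha$ is defined by $T'=\kappa n$ with $\langle n,n\rangle=\pm1$; here it is timelike, $\langle n,n\rangle=-1$. Isophote curve with spacelike axis: $\alpha$ is an isophote curve with spacelike axis $d$ if $d$ is a fixed unit spacelike vector ($\langle d,d\rangle=1$) such that $\langle N,d\rangle=\sinh\theta$ is constant along $\alpha$, where $\theta$ is the (constant) angle between $N$ and $d$; by convention $\theta\ge0$. *)

(* Defs.v *)
From HB Require Import structures.
From mathcomp Require Import all_boot all_order all_algebra.
From mathcomp Require Import all_classical all_reals all_analysis.
Set Implicit Arguments.
Unset Strict Implicit.
Unset Printing Implicit Defensive.
Import Order.TTheory GRing.Theory Num.Theory.
Import numFieldNormedType.Exports.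
Local Open Scope classical_set_scope.
Local Open Scope ring_scope.

Section Hyperbolic.
Variable R : realType.

Definition sinh (x : R) : R := (expR x - expR (- x)) / 2.
Definition cosh (x : R) : R := (expR x + expR (- x)) / 2.
Definition tanh (x : R) : R := sinh x / cosh x.

End Hyperbolic.

(* E_1^3 is 'rV[R]_3; the time coordinate x_1 is x 0 0. *)
Section MinkowskiSpace.
Variable R : realType.
Implicit Types x y : 'rV[R]_3.

Definition lorentz x y : R :=
  - (x 0 0 * y 0 0) + x 0 1 * y 0 1 + x 0 2 * y 0 2.

Definition lorentz_cross x y : 'rV[R]_3 :=
  \row_(i < 3) [:: x 0 1 * y 0 2 - x 0 2 * y 0 1;
                   x 0 0 * y 0 2 - x 0 2 * y 0 0;
                   x 0 1 * y 0 0 - x 0 0 * y 0 1]`_i.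

End MinkowskiSpace.

(* Used below only with A open and E, F finite-dimensional, where these are
   the usual C^k and C^oo classes. *)
Section Smoothness.
Variables (R : realType) (E F : normedModType R).

Fixpoint Ck_on (k : nat) (A : set E) (f : E -> F) : Prop :=
  match k with
  | 0 => forall x, A x -> {for x, continuous f}
  | k'.+1 => (forall x, A x -> differentiable f x) /\
             (forall v, Ck_on k' A (fun x => 'D_v f x))
  end.

Definition smooth_on (A : set E) (f : E -> F) : Prop :=
  forall k, Ck_on k A f.

End Smoothness.

Section Surfaces.
Variable R : realType.
Implicit Types (M : set 'rV[R]_3) (p v : 'rV[R]_3).

(* X : U -> V `&` M is a smooth homeomorphism (with inverse Y) whose
   differential is injective at every point of U. *)
Definition regular_surface M : Prop :=
  forall p, M p ->
  exists (V : set 'rV[R]_3) (U : set 'rV[R]_2)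
         (X : 'rV[R]_2 -> 'rV[R]_3) (Y : 'rV[R]_3 -> 'rV[R]_2),
    [/\ [/\ open V, V p & open U],
        X @` U = V `&` M,
        smooth_on U X,
        (forall u, U u -> Y (X u) = u) /\ {within V `&` M, continuous Y}
      & forall u, U u -> injective ('d X u)].

(* The tangent plane at p consists of the velocities of the smooth curves in
   R^3 with trace in M passing through p. *)
Definition tangent_vector M p v : Prop :=
  exists (e : R) (c : R -> 'rV[R]_3),
    [/\ 0 < e,
        smooth_on `](- e), e[%classic c,
        (forall t, - e < t < e -> M (c t)),
        c 0 = p
      & derive1 c 0 = v].

Definition spacelike_surface M : Prop :=
  forall p v, M p -> tangent_vector M p v -> v != 0 -> 0 < lorentz v v.

(* A map on a subset of R^3 is smooth when near each point of the subset it
   agrees with a smooth map on an open set of R^3. *)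
Definition smooth_on_surface M (N : 'rV[R]_3 -> 'rV[R]_3) : Prop :=
  forall p, M p ->
  exists (W : set 'rV[R]_3) (N' : 'rV[R]_3 -> 'rV[R]_3),
    [/\ open W, W p, smooth_on W N' & forall q, W q -> M q -> N' q = N q].

Definition unit_normal M (N : 'rV[R]_3 -> 'rV[R]_3) : Prop :=
  [/\ smooth_on_surface M N,
      forall p, M p -> lorentz (N p) (N p) = -1
    & forall p v, M p -> tangent_vector M p v -> lorentz (N p) v = 0].

End Surfaces.

Section Curves.
Variable R : realType.
Implicit Types (M : set 'rV[R]_3) (I : set R) (alpha n : R -> 'rV[R]_3)
  (N : 'rV[R]_3 -> 'rV[R]_3).

Definition unit_speed_curve_on M I alpha : Prop :=
  [/\ smooth_on I alpha,
      forall s, I s -> M (alpha s)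
    & forall s, I s -> lorentz (derive1 alpha s) (derive1 alpha s) = 1].

Definition timelike_principal_normal I alpha (kappa : R -> R) n : Prop :=
  forall s, I s ->
    [/\ derive1 (derive1 alpha) s = kappa s *: n s,
        lorentz (n s) (n s) = -1
      & kappa s != 0].

Definition darboux_T alpha : R -> 'rV[R]_3 := derive1 alpha.
Definition darboux_N N alpha : R -> 'rV[R]_3 := fun s => N (alpha s).
Definition darboux_B N alpha : R -> 'rV[R]_3 :=
  fun s => lorentz_cross (darboux_N N alpha s) (darboux_T alpha s).

(* These equations determine kg, kn and tg on I. *)
Definition darboux_equations N I alpha (kg kn tg : R -> R) : Prop :=
  let T := darboux_T alpha in
  let B := darboux_B N alpha in
  let Na := darboux_N N alpha in
  forall s, I s ->
    [/\ derive1 T s = kg s *: B s + kn s *: Na s,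
        derive1 B s = - kg s *: T s + tg s *: Na s
      & derive1 Na s = kn s *: T s + tg s *: B s].

Definition isophote_spacelike_axis N I alpha (d : 'rV[R]_3) (theta : R)
    : Prop :=
  [/\ lorentz d d = 1,
      0 <= theta
    & forall s, I s -> lorentz (N (alpha s)) d = sinh theta].

(* The boolean b selects the sign: + for false, - for true.  The principal
   normal being timelike forces kn != 0 on I. *)
Definition omega (b : bool) (kg kn tg : R -> R) (s : R) : R :=
  (-1) ^+ b *
  (kn s ^+ 2 / (kn s ^+ 2 + tg s ^+ 2) `^ (3 / 2)
     * derive1 (fun t => tg t / kn t) s
   + kg s / (kn s ^+ 2 + tg s ^+ 2) `^ (1 / 2)).

End Curves.

(* Main.v *)
(* Since N' = kn T + tg B, the number <N, d> is constant iff
   kn <T, d> + tg <B, d> = 0, i.e. iff the tangential part of d is a multiple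
   e (tg T - kn B) / r, with r = sqrt(kn^2 + tg^2). When <d, d> = 1 and
   <N, d> = sinh theta, e^2 = cosh^2 theta and
     d = e (tg T - kn B) / r - sinh theta N,
   where e is constant, so its sign is the sign in omega. Conversely, for
   constant e this d satisfies
     d' = (e w - sinh theta) (kn T + tg B),
   with w the value of omega for the sign +, so it is constant iff
   e w = sinh theta. *)

Require Import Defs.
From HB Require Import structures.
From mathcomp Require Import all_boot all_order all_algebra.
From mathcomp Require Import all_classical all_reals all_analysis.
From mathcomp Require Import ring lra.
Import Order.TTheory GRing.Theory Num.Theory.
Import numFieldNormedType.Exports.
Local Open Scope classical_set_scope.
Local Open Scope ring_scope.

Set Implicit Arguments.
Unset Strict Implicit.

(** * Parity of the hyperbolic functions and cosh^2 - sinh^2 = 1 *)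

Section Hyperbolic.
Variable R : realType.
Implicit Type x : R.

Lemma sinhN x : sinh (- x) = - sinh x.
Proof. by rewrite /sinh opprK; field. Qed.

Lemma coshN x : cosh (- x) = cosh x.
Proof. by rewrite /cosh opprK addrC. Qed.

Lemma tanhN x : tanh (- x) = - tanh x.
Proof. by rewrite /tanh sinhN coshN mulNr. Qed.

Lemma cosh_gt0 x : 0 < cosh x.
Proof. by rewrite divr_gt0// addr_gt0// expR_gt0. Qed.

Lemma cosh2_sub_sinh2 x : cosh x ^+ 2 - sinh x ^+ 2 = 1.
Proof.
rewrite /cosh /sinh.
transitivity (expR x * expR (- x)); first by field.
by rewrite -expRD subrr expR0.
Qed.

End Hyperbolic.

(** * Identities for the Lorentzian inner and cross products *)

Section MinkowskiAlgebra.
Variable R : realType.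
Implicit Types (x y z : 'rV[R]_3) (a b : R).

Lemma lorentzC x y : lorentz x y = lorentz y x.
Proof. by rewrite /lorentz; ring. Qed.

Lemma lorentz_comb a b x y z :
  lorentz (a *: x + b *: y) z = a * lorentz x z + b * lorentz y z.
Proof. by rewrite /lorentz !mxE; ring. Qed.

Lemma lorentz0r x : lorentz x 0 = 0.
Proof. by rewrite /lorentz !mxE; ring. Qed.

Lemma lorentz_crossl x y : lorentz (lorentz_cross x y) x = 0.
Proof. by rewrite /lorentz !mxE /=; ring. Qed.

Lemma lorentz_crossr x y : lorentz (lorentz_cross x y) y = 0.
Proof. by rewrite /lorentz !mxE /=; ring. Qed.

Lemma lorentz_cross_cross x y :
  lorentz (lorentz_cross x y) (lorentz_cross x y) =
  lorentz x y ^+ 2 - lorentz x x * lorentz y y.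
Proof. by rewrite /lorentz !mxE /=; ring. Qed.

(* Both sides are minus the Gram determinant of x, y, z. *)
Lemma lorentz_cross_sqr x y z :
  lorentz (lorentz_cross x y) z ^+ 2 =
  lorentz x x * lorentz y z ^+ 2 + lorentz y y * lorentz x z ^+ 2
  + lorentz z z * lorentz x y ^+ 2 - lorentz x x * lorentz y y * lorentz z z
  - 2 * lorentz x y * lorentz y z * lorentz x z.
Proof. by rewrite /lorentz !mxE /=; ring. Qed.

End MinkowskiAlgebra.

(** * Differentiation rules along a curve *)

Section Derivatives.
Variable R : realType.
Implicit Types (s : R) (f g : R -> 'rV[R]_3).

Lemma is_derive_unique s (h : R -> R) a b :
  is_derive s 1 h a -> is_derive s 1 h b -> a = b.
Proof. by move=> [_ <-] [_ <-]. Qed.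

Lemma is_derive_coord m n s (f : R -> 'M[R]_(m, n)) df i j :
  is_derive s 1 f df -> is_derive s 1 (fun t => f t i j) (df i j).
Proof.
move=> [fs <-]; rewrite (derive_mx fs) mxE; apply: derivableP.
exact: (derivable_mxP _ _ _).1.
Qed.

Lemma is_derive_lorentz s f g df dg :
  is_derive s 1 f df -> is_derive s 1 g dg ->
  is_derive s 1 (fun t => lorentz (f t) (g t))
    (lorentz df (g s) + lorentz (f s) dg).
Proof.
move=> fs gs.
have fE := is_derive_coord 0 _ fs.
have gE := is_derive_coord 0 _ gs.
have := is_deriveD (is_deriveD
  (is_deriveN (is_deriveM (fE 0) (gE 0)))
  (is_deriveM (fE 1) (gE 1)))
  (is_deriveM (fE 2) (gE 2)).
move=> h; apply: (is_derive_eq h).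
by rewrite /lorentz /GRing.scale /=; ring.
Qed.

Lemma derivable_cross s f g : derivable f s 1 -> derivable g s 1 ->
  derivable (fun t => lorentz_cross (f t) (g t)) s 1.
Proof.
move=> fs gs; apply/derivable_mxP => i j; rewrite ord1.
have fE k := (derivable_mxP _ _ _).1 fs 0 k.
have gE k := (derivable_mxP _ _ _).1 gs 0 k.
under [X in derivable X]eq_fun do rewrite mxE.
have H k l : derivable (fun t => f t 0 k * g t 0 l) s 1 by exact: derivableM.
by case: j => -[|[|[|//]]] jlt /=; exact: derivableB (H _ _) (H _ _).
Qed.

(** Written with partial derivatives of [F], the derivative is a sum of products, which can be
    differentiated once more when [F] and [c] are smooth. *)
Lemma is_derive_comp_curve (V : normedModType R) m s (F : 'rV[R]_m.+1 -> V)
    (c : R -> 'rV[R]_m.+1) :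
  derivable c s 1 -> differentiable F (c s) ->
  is_derive s 1 (F \o c)
    (\sum_(j < m.+1) (derive1 c s) 0 j *: 'D_(delta_mx 0 j) F (c s)).
Proof.
move=> /derivable1_diffP cs Fs.
have Fc : differentiable (F \o c) s by exact: differentiable_comp.
split; first exact/derivable1_diffP.
rewrite -derive1E derive1E'// diff_comp//= -derive1E'//.
rewrite {1}[derive1 c s]row_sum_delta linear_sum; apply: eq_bigr => j _.
by rewrite linearZ deriveE.
Qed.

(** Mean value theorem; the interval hypothesis keeps the segment between the two points inside
    [I]. *)
Lemma is_derive0_const_on (I : set R) (f : R -> R) : is_interval I ->
  (forall s, I s -> is_derive s 1 f 0) ->
  forall x y, I x -> I y -> f x = f y.
Proof.
move=> Iint f0 x y.
wlog xy : x y / x <= y.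
  by move=> H Ix Iy; have [/H->//|/ltW /H->] := leP x y.
move=> Ix Iy.
have Ixy z : x <= z <= y -> I z by exact: Iint.
have [||c _] := @MVT_segment _ f (cst 0) _ _ xy.
- move=> z; rewrite in_itv/= => /andP[xz zy]; apply/f0/Ixy.
  by rewrite !ltW.
- apply: derivable_within_continuous => z; rewrite in_itv/= => xzy.
  by have [] := f0 _ (Ixy _ xzy).
- by rewrite mul0r => /eqP; rewrite subr_eq0 => /eqP.
Qed.

(** With phi the angle of the vector (K, G), the quotient is sin phi and its derivative is cos phi
    times phi' = (K G' - G K') / (K^2 + G^2). Exchanging K and G gives the cosine. *)
Lemma is_derive_normalized s (K G : R -> R) (dK dG : R) :
  is_derive s 1 K dK -> is_derive s 1 G dG -> 0 < K s ^+ 2 + G s ^+ 2 ->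
  is_derive s 1 (fun t => G t / Num.sqrt (K t ^+ 2 + G t ^+ 2))
    (K s * (K s * dG - G s * dK) / Num.sqrt (K s ^+ 2 + G s ^+ 2) ^+ 3).
Proof.
move=> Ks Gs w_gt0.
have r_gt0 : 0 < Num.sqrt (K s ^+ 2 + G s ^+ 2) by rewrite sqrtr_gt0.
have rE := sqr_sqrtr (ltW w_gt0).
have dw : is_derive s 1 (fun t => K t ^+ 2 + G t ^+ 2)
    (2 * K s * dK + 2 * G s * dG).
  apply: (is_derive_eq (is_deriveD (is_deriveX 2 Ks) (is_deriveX 2 Gs))).
  by rewrite /GRing.scale /= !expr1; ring.
have dr := @is_derive1_comp _ _ (fun t => K t ^+ 2 + G t ^+ 2) _ _ _
  (is_derive1_sqrt w_gt0) dw.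
have h := is_deriveM Gs (@is_deriveV _ (Num.sqrt \o (fun t => K t ^+ 2 + G t ^+ 2)) _ _ _
  (lt0r_neq0 r_gt0) dr).
apply: (is_derive_eq h); rewrite /GRing.scale /=.
move: rE r_gt0; set r := Num.sqrt _ => rE r_gt0.
(* Only the r^2 in the numerator is to be replaced by K^2 + G^2; the terms in G^2 G' then cancel. *)
transitivity ((dG * r ^+ 2 - G s * (K s * dK + G s * dG)) / r ^+ 3).
  by field; rewrite lt0r_neq0.
by rewrite rE; congr (_ / _); ring.
Qed.

Lemma derive1_ratio s (K G : R -> R) (dK dG : R) :
  is_derive s 1 K dK -> is_derive s 1 G dG -> K s != 0 ->
  derive1 (fun t => G t / K t) s = (K s * dG - G s * dK) / K s ^+ 2.
Proof.
move=> Ks Gs K0; rewrite derive1E.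
have h := is_deriveM Gs (is_deriveV K0 Ks).
rewrite (derive_val (is_derive := h)) /GRing.scale /=.
by field.
Qed.

End Derivatives.

(** * A form of [omega] with square roots instead of real powers *)

Section Omega.
Variable R : realType.
Implicit Types (kg kn tg : R -> R) (s : R).

(** The length of N' = kn T + tg B when T and B are orthonormal and spacelike. *)
Definition frame_norm kn tg s : R := Num.sqrt (kn s ^+ 2 + tg s ^+ 2).

Lemma frame_norm_gt0 kn tg s : kn s != 0 -> 0 < frame_norm kn tg s.
Proof.
by move=> kn0; rewrite sqrtr_gt0 ltr_wpDr ?sqr_ge0// exprn_even_gt0.
Qed.

Lemma sqr_frame_norm kn tg s :
  frame_norm kn tg s ^+ 2 = kn s ^+ 2 + tg s ^+ 2.
Proof. by rewrite sqr_sqrtr// addr_ge0// sqr_ge0. Qed.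

(** The factor kn^2 cancels the denominator of (tg / kn)', and the exponent 3/2 splits into a square
    root followed by a cube. *)
Lemma omegaE b kg kn tg s dkn dtg : kn s != 0 ->
  is_derive s 1 kn dkn -> is_derive s 1 tg dtg ->
  omega b kg kn tg s = (-1) ^+ b *
    ((kn s * dtg - tg s * dkn) / frame_norm kn tg s ^+ 3
     + kg s / frame_norm kn tg s).
Proof.
move=> kn0 dK dG; rewrite /omega (derive1_ratio dK dG kn0).
have w0 : 0 <= kn s ^+ 2 + tg s ^+ 2 by rewrite addr_ge0// sqr_ge0.
have r0 := frame_norm_gt0 tg kn0.
have -> : (3 / 2 : R) = 2^-1 * 3%:R by field.
rewrite powRrM mul1r powR12_sqrt// powR_mulrn ?sqrtr_ge0//.
rewrite -/(frame_norm kn tg s).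
by congr (_ * (_ + _)); field; rewrite kn0 lt0r_neq0.
Qed.

End Omega.

(** * Both implications for a frame T, B, N satisfying the Darboux equations *)

Section DarbouxFrame.
Variables (R : realType) (I : set R) (T N : R -> 'rV[R]_3).
Variables kg kn tg dkn dtg : R -> R.

Let B s := lorentz_cross (N s) (T s).

Hypothesis Iopen : open I.
Hypothesis Iint : is_interval I.
Hypothesis dT :
  forall s, I s -> is_derive s 1 T (kg s *: B s + kn s *: N s).
Hypothesis dB :
  forall s, I s -> is_derive s 1 B (- kg s *: T s + tg s *: N s).
Hypothesis dN :
  forall s, I s -> is_derive s 1 N (kn s *: T s + tg s *: B s).
Hypothesis TT : forall s, I s -> lorentz (T s) (T s) = 1.
Hypothesis NN : forall s, I s -> lorentz (N s) (N s) = -1.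
Hypothesis NT : forall s, I s -> lorentz (N s) (T s) = 0.
Hypothesis kn_neq0 : forall s, I s -> kn s != 0.
Hypothesis kn_derive : forall s, I s -> is_derive s 1 kn (dkn s).
Hypothesis tg_derive : forall s, I s -> is_derive s 1 tg (dtg s).

Let r := frame_norm kn tg.
(** [p] and [q] are the sine and cosine of the angle phi of (kn, tg), so p T - q B is a unit tangent
    vector orthogonal to N'. *)
Let p s := tg s / r s.
Let q s := kn s / r s.
(* (kn tg' - tg kn') / r^3 is the derivative of the angle of (kn, tg),
   divided by r. *)
Let w s := (kn s * dtg s - tg s * dkn s) / r s ^+ 3 + kg s / r s.

Let r_gt0 s : I s -> 0 < r s.
Proof. by move=> Is; rewrite /r; apply: (frame_norm_gt0 tg); exact: kn_neq0. Qed.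

Let rE s : r s ^+ 2 = kn s ^+ 2 + tg s ^+ 2.
Proof. exact: sqr_frame_norm. Qed.

(** By the choice of [w], phi' = r w - kg; hence p' = q phi' and q' = - p phi' take the forms in
    [dp] and [dq]. *)
Let dp s : I s -> is_derive s 1 p (kn s * w s - kg s * q s).
Proof.
move=> Is; have r0 := r_gt0 Is.
have w_gt0 : 0 < kn s ^+ 2 + tg s ^+ 2 by rewrite -rE exprn_gt0.
apply: (is_derive_eq
  (is_derive_normalized (kn_derive Is) (tg_derive Is) w_gt0)).
rewrite -/(frame_norm kn tg s) -/r /w /q.
by field; rewrite lt0r_neq0.
Qed.

Let dq s : I s -> is_derive s 1 q (kg s * p s - tg s * w s).
Proof.
move=> Is; have r0 := r_gt0 Is.
have w_gt0 : 0 < tg s ^+ 2 + kn s ^+ 2 by rewrite addrC -rE exprn_gt0.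
have h := is_derive_normalized (tg_derive Is) (kn_derive Is) w_gt0.
have -> : q = fun t => kn t / Num.sqrt (tg t ^+ 2 + kn t ^+ 2).
  by apply/funext => t; rewrite addrC.
apply: (is_derive_eq h).
rewrite [tg s ^+ 2 + _]addrC -/(frame_norm kn tg s) -/r /w /p.
by field; rewrite lt0r_neq0.
Qed.

(** [S] and [C] stand for sinh theta and cosh theta, known only through C^2 - S^2 = 1. *)
Lemma constant_angle_axis (S C : R) (b : bool) :
  C ^+ 2 - S ^+ 2 = 1 ->
  (forall s, I s -> S = C * ((-1) ^+ b * w s)) ->
  exists d : 'rV[R]_3,
    lorentz d d = 1 /\ forall s, I s -> lorentz (N s) d = S.
Proof.
move=> CS SE; set e := (-1) ^+ b * C.
have eE : e ^+ 2 = C ^+ 2 by rewrite /e exprMn sqrr_sign mul1r.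
have {}SE s : I s -> S = e * w s by move=> /SE ->; rewrite /e; ring.
have [[s0 Is0]|I0] := pselect (I !=set0); last first.
  (* For empty [I] any unit spacelike vector serves. *)
  exists (delta_mx 0 1); split=> [|s Is]; last by case: I0; exists s.
  by rewrite /lorentz !mxE /=; ring.
pose D s := e *: (p s *: T s - q s *: B s) - S *: N s.
(* The derivative of [D] is (e w - S) (kn T + tg B), which vanishes because S = e w. *)
have DE s : I s -> D s = D s0.
  move=> Is; apply/matrixP => i j; move: Is Is0.
  apply: (@is_derive0_const_on _ I (fun t => D t i j) Iint) => t It.
  have Ti := is_derive_coord i j (dT It).
  have Bi := is_derive_coord i j (dB It).
  have Ni := is_derive_coord i j (dN It).
  have h := is_deriveB (is_deriveZ e (is_deriveB (is_deriveM (dp It) Ti)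
    (is_deriveM (dq It) Bi))) (is_deriveZ S Ni).
  have -> : (fun t => D t i j) =
      (fun t => e * (p t * T t i j - q t * B t i j) - S * N t i j).
    by apply/funext => u; rewrite !mxE.
  apply: (is_derive_eq h); rewrite /GRing.scale /= !mxE (SE _ It) /p /q.
  by field; rewrite lt0r_neq0// r_gt0.
exists (D s0).
have TB s : lorentz (B s) (T s) = 0 by exact: lorentz_crossr.
have NB s : lorentz (B s) (N s) = 0 by exact: lorentz_crossl.
have BB s : I s -> lorentz (B s) (B s) = 1.
  by move=> Is; rewrite lorentz_cross_cross NT// TT// NN//; ring.
have Dl s x : lorentz (D s) x = e * (p s * lorentz (T s) x
    - q s * lorentz (B s) x) - S * lorentz (N s) x.
  by rewrite /lorentz !mxE; ring.
split=> [|s Is]; last first.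
  by rewrite -(DE _ Is) lorentzC Dl NN// NB lorentzC NT//; ring.
rewrite Dl lorentzC Dl TT// TB (NT Is0) [lorentz (B _) _]lorentzC Dl.
rewrite BB// [lorentz (N _) (B _)]lorentzC NB [lorentz (T _) (B _)]lorentzC TB.
rewrite [lorentz (N _) (D _)]lorentzC Dl NN// NB [lorentz (T _) (N _)]lorentzC NT//.
(* <D, D> = e^2 (p^2 + q^2) - S^2, the minus sign coming from <N, N> = -1. *)
transitivity (e ^+ 2 * ((kn s0 ^+ 2 + tg s0 ^+ 2) / r s0 ^+ 2) - S ^+ 2).
  by rewrite /p /q; field; rewrite lt0r_neq0// r_gt0.
by rewrite -rE divff ?mulr1 ?eE// expf_neq0// lt0r_neq0// r_gt0.
Qed.

(** The axis is followed through [a] and [b], its products with T and B, which satisfy a linear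
    differential system; its coefficient [e] along p T - q B turns out constant and equal to C up to
    sign. *)
Lemma axis_constant_angle (S C : R) (d : 'rV[R]_3) :
  C ^+ 2 - S ^+ 2 = 1 -> lorentz d d = 1 ->
  (forall s, I s -> lorentz (N s) d = S) ->
  exists b : bool, forall s, I s -> S = C * ((-1) ^+ b * w s).
Proof.
move=> CS dd Nd.
have [[s0 Is0]|I0] := pselect (I !=set0); last first.
  by exists false => s Is; case: I0; exists s.
pose a s := lorentz (T s) d; pose b s := lorentz (B s) d.
have da s : I s -> is_derive s 1 a (kg s * b s + kn s * S).
  move=> Is; apply: (is_derive_eq (is_derive_lorentz (dT Is)
    (is_derive_cst d s 1))).
  by rewrite lorentz_comb Nd// lorentz0r addr0.
have db s : I s -> is_derive s 1 b (- kg s * a s + tg s * S).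
  move=> Is; apply: (is_derive_eq (is_derive_lorentz (dB Is)
    (is_derive_cst d s 1))).
  by rewrite lorentz_comb Nd// lorentz0r addr0.
(* This is the derivative of <N, d>, which is constant near s because [I] is open. *)
have ab0 s : I s -> kn s * a s + tg s * b s = 0.
  move=> Is.
  have h := is_derive_lorentz (dN Is) (is_derive_cst d s 1).
  have h0 : is_derive s 1 (fun t => lorentz (N t) d) 0.
    apply: (near_eq_is_derive _ (is_derive_cst S s 1)).
    by apply: filterS (open_nbhs_nbhs (conj Iopen Is)) => t /Nd.
  by have := is_derive_unique h0 h; rewrite lorentz_comb lorentz0r addr0 => <-.
(* The Gram identity for N, T, d gives b^2 = 1 + S^2 - a^2 without expanding d in the frame. *)
have ab2 s : I s -> a s ^+ 2 + b s ^+ 2 = C ^+ 2.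
  move=> Is; rewrite /b lorentz_cross_sqr NN// TT// dd NT// Nd// -/(a s).
  have -> : C ^+ 2 = 1 + S ^+ 2 by rewrite -CS subrK.
  by ring.
pose e s := a s * p s - b s * q s.
(* In e' the terms in [kg] cancel, those in [S] cancel because kn p = tg q, and w (kn a + tg b) = 0
   remains. *)
have eE s : I s -> e s = e s0.
  move=> Is; move: Is Is0.
  apply: (@is_derive0_const_on _ I e Iint) => t It.
  have h := is_deriveB (is_deriveM (da _ It) (dp It))
    (is_deriveM (db _ It) (dq It)).
  apply: (is_derive_eq h); rewrite /GRing.scale /=.
  transitivity (w t * (kn t * a t + tg t * b t)).
    by rewrite /p /q; field; rewrite lt0r_neq0// r_gt0.
  by rewrite ab0// mulr0.
(* The pair (a, b) is orthogonal to (kn, tg), hence a multiple of (p, - q); subtracting a multiple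
   of kn a + tg b = 0 shows this algebraically. *)
have aE s : I s -> a s = e s * p s.
  move=> Is; have r0 := lt0r_neq0 (r_gt0 Is).
  transitivity (((kn s ^+ 2 + tg s ^+ 2) * a s
    - kn s * (kn s * a s + tg s * b s)) / r s ^+ 2).
    by rewrite ab0// -rE; field.
  by rewrite /e /p /q; field.
have bE s : I s -> b s = - e s * q s.
  move=> Is; have r0 := lt0r_neq0 (r_gt0 Is).
  transitivity (((kn s ^+ 2 + tg s ^+ 2) * b s
    - tg s * (kn s * a s + tg s * b s)) / r s ^+ 2).
    by rewrite ab0// -rE; field.
  by rewrite /e /p /q; field.
have eC : e s0 ^+ 2 = C ^+ 2.
  rewrite -(ab2 _ Is0) aE// bE//.
  transitivity (e s0 ^+ 2 * ((kn s0 ^+ 2 + tg s0 ^+ 2) / r s0 ^+ 2)).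
    by rewrite -rE divff ?mulr1// expf_neq0// lt0r_neq0// r_gt0.
  by rewrite /p /q; field; rewrite lt0r_neq0// r_gt0.
(* Two derivatives of a = e p are compared: the [kg] terms cancel by b = - e q, and division by [kn]
   leaves S = e w. *)
have Se s : I s -> S = e s0 * w s.
  move=> Is.
  have h : is_derive s 1 a (e s0 * (kn s * w s - kg s * q s)).
    apply: (near_eq_is_derive _ (is_deriveZ (e s0) (dp Is))).
    apply: filterS (open_nbhs_nbhs (conj Iopen Is)) => t It.
    by rewrite (aE _ It) (eE _ It).
  have := is_derive_unique h (da _ Is).
  rewrite (bE _ Is) (eE _ Is) => h1; apply: (mulfI (kn_neq0 Is)).
  by rewrite mulrCA; apply/eqP; rewrite -subr_eq0; apply/eqP; lra.
(* The sign in [omega] is the one by which e differs from C. *)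
have /orP[/eqP eCE|/eqP eCE] : (e s0 == C) || (e s0 == - C) by rewrite -eqf_sqr eC.
- by exists false => s /Se ->; rewrite eCE mul1r.
- by exists true => s /Se ->; rewrite eCE; ring.
Qed.

End DarbouxFrame.

(** * Differentiability of the unit normal along the curve *)

Section CurveRegularity.
Variables (R : realType) (M : set 'rV[R]_3) (N : 'rV[R]_3 -> 'rV[R]_3).
Variables (I : set R) (alpha : R -> 'rV[R]_3).
Hypothesis Iopen : open I.
Hypothesis alpha_smooth : smooth_on I alpha.
Hypothesis alphaM : forall s, I s -> M (alpha s).
Hypothesis N_smooth : smooth_on_surface M N.

Lemma smooth_on_derive (E F : normedModType R) (A : set E) (f : E -> F) v :
  smooth_on A f -> smooth_on A (fun x => 'D_v f x).
Proof. by move=> fA k; have [_ dfA] := fA k.+1; exact: dfA. Qed.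

Lemma smooth_on_differentiable (E F : normedModType R) (A : set E) (f : E -> F)
  x : smooth_on A f -> A x -> differentiable f x.
Proof. by move=> /(_ 1%N) [fA _]; exact: fA. Qed.

Lemma smooth_on_derive1 (F : normedModType R) (f : R -> F) :
  smooth_on I f -> smooth_on I (derive1 f).
Proof.
have -> : derive1 f = fun t => 'D_1 f t by apply/funext => t; rewrite derive1E.
exact: smooth_on_derive.
Qed.

Lemma smooth_on_derivable (F : normedModType R) (f : R -> F) s :
  smooth_on I f -> I s -> derivable f s 1.
Proof.
by move=> fI Is; apply/derivable1_diffP; exact: smooth_on_differentiable fI Is.
Qed.

(** [N] is smooth only through local extensions [F] to open sets, so the claims are transferred to
    [F \o alpha] near s. The second derivative of the normal is what later makes [kn] and [tg]
    differentiable. *)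
Lemma derivable_darboux_N s : I s ->
  derivable (darboux_N N alpha) s 1 /\
  derivable (derive1 (darboux_N N alpha)) s 1.
Proof.
move=> Is; have [W [F [Wopen Ws Fsmooth FN]]] := N_smooth (alphaM Is).
have alphas := smooth_on_derivable alpha_smooth Is.
have near_IW : \forall t \near s, I t /\ W (alpha t).
  have Wn : nbhs (alpha s) W by exact: open_nbhs_nbhs.
  have Ins : nbhs s I by exact: open_nbhs_nbhs.
  have ac : {for s, continuous alpha}.
    exact/differentiable_continuous/derivable1_diffP.
  by apply: filterS2 Ins (ac _ Wn).
have near_FN : \forall t \near s, F (alpha t) = darboux_N N alpha t.
  by apply: filterS near_IW => t [It Wt]; exact: FN (alphaM It).
have dFalpha t : I t /\ W (alpha t) ->
    is_derive t 1 (F \o alpha)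
    (\sum_(j < 3) (derive1 alpha t) 0 j *: 'D_(delta_mx 0 j) F (alpha t)).
  move=> [It Wt]; apply: is_derive_comp_curve.
    exact: smooth_on_derivable alpha_smooth It.
  exact: smooth_on_differentiable Fsmooth Wt.
split.
  apply: (near_eq_derivable near_FN).
  by have [] := dFalpha _ (conj Is Ws).
(* The chain rule formula for the first derivative, whose factors are again differentiable at s. *)
pose G t := \sum_(j < 3) (derive1 alpha t) 0 j *: 'D_(delta_mx 0 j) F (alpha t).
apply: (@near_eq_derivable _ _ _ G).
  (* Agreement near s is also agreement near every t close to s, so the derivatives at such t
     coincide. *)
  apply: filterS2 near_IW (near_join near_FN) => t tIW nt.
  rewrite derive1E -(near_eq_derive (f := F \o alpha)).
    by rewrite (derive_val (is_derive := dFalpha _ tIW)).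
  exact: nt.
apply/derivable_mxP => i k.
have -> : (fun t => G t i k) =
    \sum_(j < 3) (fun t => derive1 alpha t 0 j * 'D_(delta_mx 0 j) F (alpha t) i k).
  by apply/funext => t; rewrite summxE fct_sumE; apply: eq_bigr => j _; rewrite mxE.
apply: derivable_sum => j; apply: derivableM.
  apply: (derivable_mxP _ _ _).1.
  exact: smooth_on_derivable (smooth_on_derive1 alpha_smooth) Is.
apply: (derivable_mxP _ _ _).1; apply/derivable1_diffP.
apply: (@differentiable_comp _ _ _ _ alpha (fun x => 'D_(delta_mx 0 j) F x)).
  exact/derivable1_diffP.
exact: smooth_on_differentiable (smooth_on_derive _ Fsmooth) Ws.
Qed.

End CurveRegularity.

(** * Orthogonality of the frame, regularity of the curvatures, and the equivalence for fixed
    theta *)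

Section DarbouxCurve.
Variables (R : realType) (N : 'rV[R]_3 -> 'rV[R]_3) (I : set R).
Variables (alpha n : R -> 'rV[R]_3) (kappa kg kn tg : R -> R).
Hypothesis Iopen : open I.
Hypothesis T_derivable : forall s, I s -> derivable (derive1 alpha) s 1.
Hypothesis N_derivable : forall s, I s -> derivable (darboux_N N alpha) s 1.
Hypothesis N_derivable2 :
  forall s, I s -> derivable (derive1 (darboux_N N alpha)) s 1.
Hypothesis TT : forall s, I s -> lorentz (derive1 alpha s) (derive1 alpha s) = 1.
Hypothesis NN : forall s, I s -> lorentz (N (alpha s)) (N (alpha s)) = -1.
Hypothesis alpha_n : timelike_principal_normal I alpha kappa n.
Hypothesis alphaD : darboux_equations N I alpha kg kn tg.

Let T := darboux_T alpha.
Let B := darboux_B N alpha.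
Let Na := darboux_N N alpha.

Lemma is_derive_derive1 (f : R -> 'rV[R]_3) s (v : 'rV[R]_3) :
  derivable f s 1 -> derive1 f s = v -> is_derive s 1 f v.
Proof. by move=> fs <-; rewrite derive1E; exact: derivableP. Qed.

Lemma darboux_T_derive s : I s -> is_derive s 1 T (kg s *: B s + kn s *: Na s).
Proof.
by move=> Is; have [Ts _ _] := alphaD Is; apply: is_derive_derive1 Ts; exact: T_derivable.
Qed.

Lemma darboux_B_derive s : I s ->
  is_derive s 1 B (- kg s *: T s + tg s *: Na s).
Proof.
move=> Is; have [_ Bs _] := alphaD Is; apply: is_derive_derive1 Bs.
by apply: derivable_cross; [exact: N_derivable|exact: T_derivable].
Qed.

Lemma darboux_N_derive s : I s -> is_derive s 1 Na (kn s *: T s + tg s *: B s).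
Proof.
by move=> Is; have [_ _ Ns] := alphaD Is; apply: is_derive_derive1 Ns; exact: N_derivable.
Qed.

(** If kn = 0, then T' = kg B has <T', T'> >= 0, against <T', T'> = - kappa^2 < 0. *)
Lemma darboux_kn_neq0 s : I s -> kn s != 0.
Proof.
move=> Is; have [Ts _ _] := alphaD Is; have [an nn k0] := alpha_n Is.
have TT' : lorentz (derive1 (derive1 alpha) s) (derive1 (derive1 alpha) s)
    = - kappa s ^+ 2.
  (* A zero term is added so that [lorentz_comb] applies. *)
  rewrite an -[kappa s *: n s]addr0 -[X in _ + X](scale0r (0 : 'rV[R]_3)).
  rewrite lorentz_comb mul0r addr0 lorentzC lorentz_comb nn; ring.
apply/eqP => kn0; move: TT'; rewrite Ts kn0.
rewrite lorentz_comb mul0r addr0 lorentzC lorentz_comb mul0r addr0.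
(* [darboux_NT] relies on kn != 0, so <N, T> = 0 is not at hand yet; <B, B> = <N, T>^2 + 1 >= 0
   suffices. *)
rewrite lorentz_cross_cross (NN Is) (TT Is) => /eqP.
apply/negP; rewrite gt_eqF// (@lt_le_trans _ _ 0)//.
  by rewrite oppr_lt0 exprn_even_gt0.
rewrite mulrA -expr2 mulr_ge0 ?sqr_ge0// mulr1 opprK.
by rewrite addr_ge0// sqr_ge0.
Qed.

(* Differentiating <N, N> = -1 gives 2 kn <N, T> = 0. *)
Lemma darboux_NT s : I s -> lorentz (Na s) (T s) = 0.
Proof.
move=> Is.
have h := is_derive_lorentz (darboux_N_derive Is) (darboux_N_derive Is).
have h0 : is_derive s 1 (fun t => lorentz (Na t) (Na t)) 0.
  apply: (near_eq_is_derive _ (is_derive_cst (-1 : R) s 1)).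
  by apply: filterS (open_nbhs_nbhs (conj Iopen Is)) => t /NN.
have := is_derive_unique h0 h.
rewrite [lorentz (Na s) (_ + _)]lorentzC lorentz_comb lorentz_crossl.
rewrite mulr0 addr0 lorentzC -mulr2n => /esym/eqP.
by rewrite mulrn_eq0/= mulf_eq0 (negPf (darboux_kn_neq0 Is)) => /eqP.
Qed.

Lemma darboux_BB s : I s -> lorentz (B s) (B s) = 1.
Proof.
move=> Is; rewrite lorentz_cross_cross darboux_NT// (NN Is) (TT Is).
by ring.
Qed.

(** [kn] and [tg] are known only through the Darboux equations; being inner products of
    differentiable fields on the open set [I], they are differentiable. *)
Lemma darboux_knE s : I s -> lorentz (derive1 Na s) (T s) = kn s.
Proof.
move=> Is; have [_ _ ->] := alphaD Is.
by rewrite lorentz_comb (TT Is) lorentz_crossr; ring.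
Qed.

Lemma darboux_tgE s : I s -> lorentz (derive1 Na s) (B s) = tg s.
Proof.
move=> Is; have [_ _ ->] := alphaD Is.
by rewrite lorentz_comb darboux_BB// lorentzC lorentz_crossr; ring.
Qed.

Lemma derivable_kn s : I s -> derivable kn s 1.
Proof.
move=> Is.
apply: (@near_eq_derivable _ _ _ (fun t => lorentz (derive1 Na t) (T t))).
  by apply: filterS (open_nbhs_nbhs (conj Iopen Is)) => t /darboux_knE.
have [+ _] := is_derive_lorentz (derivableP (N_derivable2 Is)) (darboux_T_derive Is).
by [].
Qed.

Lemma derivable_tg s : I s -> derivable tg s 1.
Proof.
move=> Is.
apply: (@near_eq_derivable _ _ _ (fun t => lorentz (derive1 Na t) (B t))).
  by apply: filterS (open_nbhs_nbhs (conj Iopen Is)) => t /darboux_tgE.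
have [+ _] := is_derive_lorentz (derivableP (N_derivable2 Is)) (darboux_B_derive Is).
by [].
Qed.

(** With S = sinh theta and C = cosh theta, the equation linking S, C and [w] in the two frame
    lemmas becomes the one for tanh theta after division by cosh theta > 0. *)
Lemma isophote_tanh_omega theta : is_interval I -> 0 <= theta ->
  (exists d : 'rV[R]_3, isophote_spacelike_axis N I alpha d theta) <->
  (exists b : bool, forall s, I s -> tanh theta = omega b kg kn tg s).
Proof.
move=> Iint theta0.
have kn0 := darboux_kn_neq0; have NT := darboux_NT.
have dkn s : I s -> is_derive s 1 kn ('D_1 kn s).
  by move=> Is; exact/derivableP/derivable_kn.
have dtg s : I s -> is_derive s 1 tg ('D_1 tg s).
  by move=> Is; exact/derivableP/derivable_tg.
have C0 : cosh theta != 0 by rewrite gt_eqF// cosh_gt0.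
split=> [[d [dd _ Nd]]|[b tanhE]].
- have [b SE] := axis_constant_angle Iopen Iint darboux_T_derive
    darboux_B_derive darboux_N_derive TT NN NT kn0 dkn dtg
    (cosh2_sub_sinh2 theta) dd Nd.
  exists b => s Is.
  by rewrite (omegaE _ _ (kn0 _ Is) (dkn _ Is) (dtg _ Is)) /tanh (SE _ Is) mulrC mulKf.
- have SE s : I s -> sinh theta = cosh theta * ((-1) ^+ b *
    ((kn s * 'D_1 tg s - tg s * 'D_1 kn s) / frame_norm kn tg s ^+ 3
     + kg s / frame_norm kn tg s)).
    move=> Is; rewrite -(omegaE _ _ (kn0 _ Is) (dkn _ Is) (dtg _ Is)) -tanhE//.
    by rewrite /tanh mulrC divfK.
  have [d [dd Nd]] := constant_angle_axis Iint darboux_T_derive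
    darboux_B_derive darboux_N_derive TT NN NT kn0 dkn dtg
    (cosh2_sub_sinh2 theta) SE.
  by exists d.
Qed.

End DarbouxCurve.

(** * The choice of sign, and the theorem *)

Lemma omega_negb (R : realType) b (kg kn tg : R -> R) s :
  omega (~~ b) kg kn tg s = - omega b kg kn tg s.
Proof. by rewrite /omega signrN mulNr. Qed.

Unset Implicit Arguments.
Set Strict Implicit.

Theorem theorem3 (R : realType) (M : set 'rV[R]_3)
    (N : 'rV[R]_3 -> 'rV[R]_3) (I : set R) (alpha n : R -> 'rV[R]_3)
    (kappa kg kn tg : R -> R)
    (hM : regular_surface M) (hMs : spacelike_surface M)
    (hN : unit_normal M N)
    (hIo : open I) (hI : is_interval I)
    (halpha : unit_speed_curve_on M I alpha)
    (hn : timelike_principal_normal I alpha kappa n)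
    (hD : darboux_equations N I alpha kg kn tg) :
  (forall theta : R, 0 <= theta ->
     ((exists d : 'rV[R]_3, isophote_spacelike_axis N I alpha d theta) <->
      (exists b : bool, forall s, I s -> tanh theta = omega b kg kn tg s)))
  /\
  ((exists (d : 'rV[R]_3) (theta : R),
      isophote_spacelike_axis N I alpha d theta) <->
   (exists (theta : R) (b : bool),
      forall s, I s -> omega b kg kn tg s = tanh theta)).
Proof.
have [N_smooth NN _] := hN; have [alpha_smooth alphaM TT] := halpha.
have N_derivable := derivable_darboux_N hIo alpha_smooth alphaM N_smooth.
have key theta (theta0 : 0 <= theta) := isophote_tanh_omega hIo
  (fun s => smooth_on_derivable (smooth_on_derive1 alpha_smooth))
  (fun s Is => (N_derivable s Is).1) (fun s Is => (N_derivable s Is).2)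
  TT (fun s Is => NN _ (alphaM s Is)) hn hD hI theta0.
split=> //; split=> [[d [theta [dd theta0 Nd]]]|[theta [b omegaE]]].
  have [b bE] := (key _ theta0).1 (ex_intro _ d (And3 dd theta0 Nd)).
  by exists theta, b => s /bE.
have [theta0|/ltW theta0] := leP 0 theta.
  have [|d dE] := (key _ theta0).2; last by exists d, theta.
  by exists b => s /omegaE.
(* A negative theta is replaced by - theta: tanh is odd, and the opposite sign is taken in
   [omega]. *)
have theta'0 : 0 <= - theta by rewrite oppr_ge0.
have [|d dE] := (key _ theta'0).2; last by exists d, (- theta).
by exists (~~ b) => s /omegaE; rewrite omega_negb tanhN => ->.
Qed.
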